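(* Let $G$ be an abelian group (written multiplicatively), let $G_0=G\amalg\{0\}$, and let $2^{G_0}$ be the multiplicative lattice of all subsets of $G_0$. A self-map $r$ of $2^{G_0}$ is a module system on $G$ if and only if $r$ is a nucleus on $2^{G_0}$ such that $\emptyset^r=\{0\}$. Moreover, the following are equivalent for any self-map $r$ of $2^{G_0}$ such that $\emptyset^r=\{0\}$. (1) $r$ is a module system on $G$. (2) $r$ is a closure operation on the poset $2^{G_0}$ and $r$-multiplication $(X,Y)\mapsto (XY)^r$ is associative. (3) $r$ is a closure operation on the poset $2^{G_0}$ and $(X^rY^r)^r=(XY)^r$ for all $X,Y\in 2^{G_0}$. (4) For all $X,Y,Z\subset G_0$, one has $XY\subset Z^r$ if and only if $XY^r\subset Z^r$.
   Context: For a self-map $r$ of a set, write $x^r=r(x)$. The multiplication of $G$ is extended to $G_0=G\amalg\{0\}$ by $0x=0=x0$ for all $x\in G_0$. The power set $2^{G_0}$ is ordered by inclusion and has multiplication $XY=\{xy: x\in X, y\in Y\}$; for $c\in G_0$, $cX=\{cx:x\in X\}$. A closure operation on a poset $S$ is a self-map that is expansive ($x\le x^r$), order-preserving, and idempotent. A nucleus on an ordered magma $M$ (a magma with a partial order compatible with multiplication) is a closure operation $r$ on $M$ with $x^ry^r\le (xy)^r$ for all $x,y\in M$. A module system on $G$ is a closure operation $r$ on the poset $2^{G_0}$ such that $\emptyset^r=\{0\}$ and $(cX)^r=cX^r$ for all $c\in G_0$ and all $X\subset G_0$. *)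

(* Defs.v *)
From HB Require Import structures.
From mathcomp Require Import all_boot all_order.
From mathcomp Require Import monoid boolp classical_sets.

Set Implicit Arguments.
Unset Strict Implicit.
Unset Printing Implicit Defensive.


Local Open Scope classical_set_scope.
Local Open Scope group_scope.

HB.mixin Record Magma_isOrdered d M of Magma M & Order.POrder d M := {
  lemul : forall x x' y y' : M,
    (x <= x')%O -> (y <= y')%O -> (x * y <= x' * y')%O
}.

#[short(type="orderedMagmaType")]
HB.structure Definition OrderedMagma d :=
  { M of Magma_isOrdered d M & Magma M & Order.POrder d M }.

Definition closure_operation d (S : porderType d) (r : S -> S) : Prop :=
  [/\ forall x, (x <= r x)%O,
      forall x y, (x <= y)%O -> (r x <= r y)%O &
      forall x, r (r x) = r x].

Definition nucleus d (M : orderedMagmaType d) (r : M -> M) : Prop :=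
  closure_operation r /\ forall x y : M, (r x * r y <= r (x * y))%O.

(* [None] is the adjoined absorbing element 0 *)
Definition with_zero (G : Type) : Type := option G.

Definition zero_elt (G : Type) : with_zero G := None.
Arguments zero_elt {G}.

Definition with_zero_mul (G : magmaType) (x y : with_zero G) : with_zero G :=
  if (x, y) is (Some a, Some b) then Some (a * b) else None.

HB.instance Definition _ (G : magmaType) :=
  hasMul.Build (with_zero G) (@with_zero_mul G).

Definition set_mul (M : magmaType) (X Y : set M) : set M :=
  [set x * y | x in X & y in Y].

HB.instance Definition _ (M : magmaType) := hasMul.Build (set M) (@set_mul M).

Fact set_lemul (M : magmaType) (X X' Y Y' : set M) :
  (X <= X')%O -> (Y <= Y')%O -> (X * Y <= X' * Y')%O.
Proof. by rewrite !subsetEset => XX' YY'; exact: image2_subset. Qed.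

(* On [set M] the order [<=] is inclusion, see [subsetEset]. *)
HB.instance Definition _ (M : magmaType) :=
  Magma_isOrdered.Build set_display (set M) (@set_lemul M).

Definition scale_set (M : magmaType) (c : M) (X : set M) : set M :=
  [set c * x | x in X].

Definition module_system (G : groupType)
    (r : set (with_zero G) -> set (with_zero G)) : Prop :=
  [/\ closure_operation r,
      r set0 = [set zero_elt] &
      forall (c : with_zero G) (X : set (with_zero G)),
        r (scale_set c X) = scale_set c (r X)].

(* Main.v *)
(** Since [X * Y] is the union of the [c * Y] for [c] in [X], compatibility of
    a closure operation [r] with scaling by all elements yields
    [X * r Y <= r (X * Y)], which by commutativity is the nucleus inequality.
    Conversely, substituting the unit set into (2) or (4) recovers the
    one-sided identities, and [c * r X = r (c * X)] follows because [c] is either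
    invertible or [0]; the latter case is where [r set0 = {0}] enters. *)
Require Import Defs.
From mathcomp Require Import all_boot all_order.
From mathcomp Require Import monoid boolp classical_sets.

Local Open Scope classical_set_scope.
Local Open Scope group_scope.

Section ClosureOperations.
Context {T : Type} {r : set T -> set T} (clo : closure_operation r).

Lemma closure_operation_sub X : X `<=` r X.
Proof. by case: clo => + _ _; move/(_ X); rewrite subsetEset. Qed.

Lemma closure_operation_mono {X Y} : X `<=` Y -> r X `<=` r Y.
Proof. by case: clo => _ + _; move/(_ X Y); rewrite !subsetEset. Qed.

Lemma closure_operation_idem X : r (r X) = r X.
Proof. by case: clo. Qed.

(** Minimality: [r X] is the least closed set containing [X]. *)
Lemma closure_operation_min {X Y} : X `<=` r Y -> r X `<=` r Y.
Proof. by move=> /closure_operation_mono; rewrite closure_operation_idem. Qed.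

End ClosureOperations.

(** The trivial inclusion of [r X] in itself, read backwards, gives expansiveness; read forwards,
    with [r X] as the left set, it gives idempotence. *)
Lemma closure_operation_of_min (T : Type) (r : set T -> set T) :
  (forall X Y, X `<=` r Y <-> r X `<=` r Y) -> closure_operation r.
Proof.
move=> rP; have r_sub X : X `<=` r X by apply/(rP X X).
have r_mono X Y : X `<=` Y -> r X `<=` r Y.
  by move=> XY; apply/(rP X Y); apply: subset_trans XY (r_sub Y).
split=> [X|X Y|X]; rewrite ?subsetEset //; first exact: r_mono.
by apply/seteqP; split; [apply/(rP (r X) X)|exact: r_sub].
Qed.

Section SetMul.
Context {M : magmaType}.
Implicit Types (X Y : set M) (c : M).

Lemma set_mulS X X' Y Y' : X `<=` X' -> Y `<=` Y' -> X * Y `<=` X' * Y'.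
Proof. exact: image2_subset. Qed.

Lemma set_mulP X Y Z :
  X * Y `<=` Z <-> forall x y, X x -> Y y -> Z (x * y).
Proof.
split=> [XYZ x y Xx Yy|XYZ _ [x Xx [y Yy <-]]]; last exact: XYZ.
by apply: XYZ; exists x => //; exists y.
Qed.

Lemma set_mul1l c X : [set c] * X = scale_set c X.
Proof.
apply/seteqP; split=> [_ [_ -> [x Xx <-]]|_ [x Xx <-]]; first by exists x.
by exists c => //; exists x.
Qed.

Lemma set_mulA : associative (fun x y : M => x * y) ->
  associative (fun X Y : set M => X * Y).
Proof.
move=> mulA X Y Z; apply/seteqP; split.
  move=> _ [x Xx [_ [y Yy [z Zz <-]] <-]]; rewrite mulA.
  by exists (x * y); [exists x => //; exists y|exists z].
move=> _ [_ [x Xx [y Yy <-]] [z Zz <-]]; rewrite -mulA.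
by exists x => //; exists (y * z) => //; exists y => //; exists z.
Qed.

Lemma set_mulC : commutative (fun x y : M => x * y) ->
  commutative (fun X Y : set M => X * Y).
Proof.
move=> mulC X Y; apply/seteqP; split=> _ [x Xx [y Yy <-]]; rewrite mulC;
  by exists y => //; exists x.
Qed.

Lemma set_mul_unitl {e} : left_id e (fun x y : M => x * y) ->
  left_id [set e] (fun X Y : set M => X * Y).
Proof.
move=> mul1 X; rewrite set_mul1l /scale_set.
by apply/seteqP; split=> [_ [x Xx <-]|x Xx]; [rewrite mul1|exists x].
Qed.

Lemma set_mul_unitr {e} : right_id e (fun x y : M => x * y) ->
  right_id [set e] (fun X Y : set M => X * Y).
Proof.
move=> mul1 X; apply/seteqP; split=> [_ [x Xx [_ -> <-]]|x Xx].
  by rewrite mul1.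
by exists x => //; exists e.
Qed.

End SetMul.

Section WithZero.
Context {G : groupType}.
Implicit Types (x y z : with_zero G) (X : set (with_zero G)).

Lemma with_zero_mulA : associative (fun x y => x * y).
Proof. by move=> [a|] [b|] [c|] //; congr Some; exact: mulgA. Qed.

Lemma with_zero_mulC : (forall a b : G, a * b = b * a) ->
  commutative (fun x y => x * y).
Proof. by move=> Gab [a|] [b|] //; congr Some; exact: Gab. Qed.

Lemma with_zero_mul1 : left_id (Some 1 : with_zero G) (fun x y => x * y).
Proof. by move=> [a|] //; congr Some; exact: mul1g. Qed.

Lemma with_zero_mulr1 : right_id (Some 1 : with_zero G) (fun x y => x * y).
Proof. by move=> [a|] //; congr Some; exact: mulg1. Qed.

Lemma scale_set_zero X : X !=set0 -> scale_set zero_elt X = [set zero_elt].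
Proof.
by case=> x Xx; apply/seteqP; split=> [_ [y Xy <-] //|_ ->]; exists x.
Qed.

(** Invertible scalars act bijectively on subsets; this turns a one-sided scaling inclusion into an
    equality. *)
Lemma scale_setK {a b : G} X : a * b = 1 ->
  scale_set (Some a : with_zero G) (scale_set (Some b : with_zero G) X) = X.
Proof.
move=> ab1; rewrite -!set_mul1l (set_mulA with_zero_mulA).
rewrite [_ * [set _]](_ : _ = [set Some 1 : with_zero G]).
  exact: (set_mul_unitl with_zero_mul1).
by rewrite set_mul1l /scale_set image_set1 -ab1.
Qed.

End WithZero.

Lemma nucleus_subset {M : magmaType} {r : set M -> set M} : nucleus r ->
  forall X Y, r X * r Y `<=` r (X * Y).
Proof. by move=> [_ rM] X Y; have := rM X Y; rewrite subsetEset. Qed.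

(** One inclusion is the nucleus inequality followed by minimality, the other is expansiveness in
    both factors. *)
Lemma nucleus_mul_closure {M : magmaType} {r : set M -> set M} : nucleus r ->
  forall X Y, r (r X * r Y) = r (X * Y).
Proof.
move=> nuc X Y; have [clo _] := nuc; apply/seteqP; split.
  exact: (closure_operation_min clo (nucleus_subset nuc X Y)).
apply: (closure_operation_mono clo).
by apply: set_mulS; exact: closure_operation_sub.
Qed.

Lemma mul_closure_residual {M : magmaType} {r : set M -> set M} :
  closure_operation r -> (forall X Y, r (r X * r Y) = r (X * Y)) ->
  forall X Y Z, X * Y `<=` r Z <-> X * r Y `<=` r Z.
Proof.
move=> clo rM X Y Z; have r_sub := closure_operation_sub clo.
split=> [XYZ|]; last by apply: subset_trans; exact: set_mulS.
apply: subset_trans (closure_operation_min clo XYZ); rewrite -rM.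
by apply: subset_trans (r_sub _); exact: set_mulS.
Qed.

Lemma mul_closure_assoc {M : magmaType} {r : set M -> set M} :
  associative (fun x y : M => x * y) ->
  closure_operation r -> (forall X Y, r (r X * r Y) = r (X * Y)) ->
  associative (fun X Y => r (X * Y)).
Proof.
move=> mulA clo rM X Y Z; have idem := closure_operation_idem clo.
(* Both bracketings equal [r (X * Y * Z)]: closing an inner product changes nothing under the outer
   [r]. *)
by rewrite -rM idem rM (set_mulA mulA) -rM -[in RHS]rM idem.
Qed.

Lemma assoc_mul_closure {M : magmaType} {e : M} {r : set M -> set M} :
  left_id e (fun x y : M => x * y) -> right_id e (fun x y : M => x * y) ->
  closure_operation r -> associative (fun X Y => r (X * Y)) ->
  forall X Y, r (r X * r Y) = r (X * Y).
Proof.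
move=> e1 e2 clo rA X Y; have idem := closure_operation_idem clo.
(* Associativity at [Z], [W], [[set e]] reads [r (Z * r W) = r (r (Z * W))]. *)
have rr Z W : r (Z * r W) = r (Z * W).
  by have := rA Z W [set e]; rewrite !(set_mul_unitr e2) idem.
have rl Z W : r (r Z * W) = r (Z * W).
  by have := rA [set e] Z W; rewrite !(set_mul_unitl e1) idem.
by rewrite rr rl.
Qed.

Lemma module_system_nucleus {G : groupType}
    {r : set (with_zero G) -> set (with_zero G)} :
  (forall a b : G, a * b = b * a) -> module_system r -> nucleus r.
Proof.
move=> Gab [clo _ rZ]; have mulC := set_mulC (with_zero_mulC Gab).
have rr X Y : X * r Y `<=` r (X * Y).
  apply/set_mulP => c y Xc rYy.
  (* The point [c * y] lies in [c * r Y = r (c * Y)], and [c * Y] is part of [X * Y]. *)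
  apply: (closure_operation_mono clo (X := scale_set c Y)).
    by rewrite -set_mul1l; apply: set_mulS => // _ ->.
  by rewrite rZ; exists y.
(* The one-sided inclusion is used twice: first to free [Y], then, after commuting the factors, to
   free [X]. *)
split=> // X Y; rewrite subsetEset; apply: subset_trans (rr _ _) _.
by apply: (closure_operation_min clo); rewrite mulC (mulC X).
Qed.

Lemma residual_module_system {G : groupType}
    {r : set (with_zero G) -> set (with_zero G)} :
  r set0 = [set zero_elt] ->
  (forall X Y Z, X * Y `<=` r Z <-> X * r Y `<=` r Z) ->
  module_system r.
Proof.
move=> r0 rP; have mul1 := set_mul_unitl (with_zero_mul1 (G := G)).
have clo : closure_operation r.
  (* Multiplying by the unit set [[set Some 1]] removes the left factor from the residuation law. *)
  apply: closure_operation_of_min => X Y.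
  by have := rP [set Some 1 : with_zero G] X Y; rewrite !mul1.
have r_sub := closure_operation_sub clo.
have rZ_ge c X : scale_set c (r X) `<=` r (scale_set c X).
  by rewrite -!set_mul1l; apply/(rP _ X).
split=> // -[a|] X; apply/seteqP; split=> //.
  (* The reverse inclusion is [rZ_ge] for the scalar inverse to [a] and the set [a * X], scaled back
     by [a]. *)
  rewrite -[X in X `<=` _](scale_setK _ (mulgV a)).
  apply: image_subset; apply: subset_trans (rZ_ge _ _) _.
  by rewrite scale_setK // mulVg.
(* For the scalar 0, [r X] is nonempty because it contains [r set0 = {0}]. As [X] itself may be
   empty, [0 * X] is only known to lie in [{0}], which is closed. *)
rewrite -/zero_elt (scale_set_zero (r X)); last first.
  by exists zero_elt; apply: (closure_operation_mono clo (sub0set X)); rewrite r0.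
by rewrite -r0; apply: (closure_operation_min clo); rewrite r0 => _ [x _ <-].
Qed.

Theorem theorem1p5 (G : groupType) (Gab : forall a b : G, a * b = b * a) :
  (forall r : set (with_zero G) -> set (with_zero G),
      module_system r <-> nucleus r /\ r set0 = [set zero_elt]) /\
  (forall r : set (with_zero G) -> set (with_zero G),
      r set0 = [set zero_elt] ->
      [<-> module_system r;
           closure_operation r /\
             associative (fun X Y : set (with_zero G) => r (X * Y));
           closure_operation r /\
             (forall X Y : set (with_zero G), r (r X * r Y) = r (X * Y));
           forall X Y Z : set (with_zero G),
             X * Y `<=` r Z <-> X * r Y `<=` r Z]).
Proof.
split=> r.
  split=> [ms|[nuc r0]].
    by split; [exact: (module_system_nucleus Gab)|case: ms].
  (* The converse passes through the residuation law (4). *)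
  apply: (residual_module_system r0); apply: mul_closure_residual.
    by case: nuc.
  exact: nucleus_mul_closure.
move=> r0; tfae.
- move=> /(module_system_nucleus Gab) nuc; have [clo _] := nuc.
  split=> //; apply: (mul_closure_assoc _ clo); first exact: with_zero_mulA.
  exact: nucleus_mul_closure.
- move=> [clo rA]; split=> //.
  exact: (assoc_mul_closure with_zero_mul1 with_zero_mulr1 clo rA).
- by move=> [clo rM]; exact: mul_closure_residual.
- exact: residual_module_system.
Qed.
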